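(* Suppose there exists a generalized solution of the Cauchy problem for the 2-D pressureless gas system, with the initial data described in the context, in the single-shock form with the shock formulas given in the context, and that the shock surface $\mathcal S$ is given by parametric equations $x=x(t,l)$, $y=y(t,l)$. Then the following system of equations holds: $$(\widetilde P_t)^{\cdot}+x_l\{V(\varrho_+-\varrho_-)-(\varrho_+v_+-\varrho_-v_-)\}+y_l\{(\varrho_+u_+-\varrho_-u_-)-U(\varrho_+-\varrho_-)\}=0,$$ $$(\widetilde I_t)^{\cdot}+x_l\{V(\varrho_+u_+-\varrho_-u_-)-(\varrho_+u_+v_+-\varrho_-u_-v_-)\}+y_l\{(\varrho_+u_+^2-\varrho_-u_-^2)-U(\varrho_+u_+-\varrho_-u_-)\}=0,$$ $$(\widetilde J_t)^{\cdot}+x_l\{V(\varrho_+v_+-\varrho_-v_-)-(\varrho_+v_+^2-\varrho_-v_-^2)\}+y_l\{(\varrho_+u_+v_+-\varrho_-u_-v_-)-U(\varrho_+v_+-\varrho_-v_-)\}=0,$$ $$\dot y=V,\qquad \dot x=U,$$ where $U=\widetilde I_t/\widetilde P_t$, $V=\widetilde J_t/\widetilde P_t$, the dot denotes differentiation with respect to $t$ (at fixed $l$), and $\varrho_\pm,u_\pm,v_\pm$ are evaluated at $(t,x(t,l),y(t,l))$.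
   Context: The system is $\varrho_t+(\varrho u)_x+(\varrho v)_y=0$, $(\varrho u)_t+(\varrho u^2)_x+(\varrho uv)_y=0$, $(\varrho v)_t+(\varrho uv)_x+(\varrho v^2)_y=0$. Subscripts $\tau,l,a,b$ denote derivatives; $t$ in $\widetilde P_t,\widetilde I_t,\widetilde J_t$ is a time index. Initial data: $\mathcal G=\{(A(l),B(l))\}$ is a $C^1$ curve with $A_l,B_l\ge0$, $A_l^2+B_l^2\ne0$, equal to $\{G=0\}$, $G\in C^1(\mathbb R^2)$; $\mathcal G^\mp=\{G\lessgtr0\}$. The data are $(\varrho_0,u_0,v_0)=(\varrho_0^j,u_0^j,v_0^j)(a,b)$ in $\mathcal G^j$, $j=+,-$, with $\varrho_0>0$ piecewise $C^1$, $u_0^j,v_0^j\in C^1(\overline{\mathcal G^j})$, and $A_lv_0^--B_lu_0^-<0$, $A_lv_0^+-B_lu_0^+>0$ on $\mathcal G$. Times are small enough that the maps $(a,b)\mapsto(a+tu_0^j,b+tv_0^j)$ are locally nondegenerate near $\mathcal G$ and characteristics from the same side do not cross. Single-shock form: on the two sides of a surface $\mathcal S$ with $\mathcal S\cap\{t=0\}=\mathcal G$, the solution is given by classical solutions $(\varrho_j,u_j,v_j)(t,x,y)$, $j=+,-$: $$u_j(t,x,y)=u_0^j(a,b),\quad v_j(t,x,y)=v_0^j(a,b),\quad \varrho_j(t,x,y)=\varrho_0^j(a,b)\Big/\frac{\partial(x,y)}{\partial(a,b)},\qquad x=a+tu_0^j(a,b),\ y=b+tv_0^j(a,b);$$ on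 $\mathcal S\cap\{t=\mathrm{const}\}$ there are concentrated mass and momenta with $C^1$ densities $\widetilde P_t,\widetilde I_t,\widetilde J_t$ with respect to $dl$. The $C^1$ functions $a_j(t,l),b_j(t,l)$ are the initial positions, in $\overline{\mathcal G^j}$, of characteristics reaching the shock: $x(t,l)=a_j+tu_0^j(a_j,b_j)$, $y(t,l)=b_j+tv_0^j(a_j,b_j)$. Shock formulas: $(x,y)(0,l)=(A(l),B(l))$, the shock is parametrized so that $\partial x/\partial t=\widetilde I_t/\widetilde P_t$, $\partial y/\partial t=\widetilde J_t/\widetilde P_t$, and, with $M_j=(a_j)_\tau(b_j)_l-(b_j)_\tau(a_j)_l$ and $\varrho_0^j,u_0^j,v_0^j$ evaluated at $(a_j,b_j)(\tau,l)$, $$\widetilde P_t=\int_0^t[\varrho_0^+M_+-\varrho_0^-M_-]d\tau,\quad \widetilde I_t=\int_0^t[\varrho_0^+u_0^+M_+-\varrho_0^-u_0^-M_-]d\tau,\quad \widetilde J_t=\int_0^t[\varrho_0^+v_0^+M_+-\varrho_0^-v_0^-M_-]d\tau.$$ *)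

(* Defs.v *)
From HB Require Import structures.
From mathcomp Require Import all_boot all_order all_algebra.
From mathcomp Require Import all_classical all_reals all_analysis.

Set Implicit Arguments.
Unset Strict Implicit.
Unset Printing Implicit Defensive.

Import Order.TTheory GRing.Theory Num.Theory.
Import numFieldNormedType.Exports.

Local Open Scope classical_set_scope.
Local Open Scope ring_scope.

(* Points of R * R are either positions (x, y), initial positions (a, b), or
   surface parameters (t, l). *)

Definition d1 (R : realType) (f : R * R -> R) (p : R * R) : R := 'D_(1, 0) f p.
Definition d2 (R : realType) (f : R * R -> R) (p : R * R) : R := 'D_(0, 1) f p.

(* f is C^1 in the open set D, and f and its partial derivatives extend
   continuously to E, where D `<=` E `<=` closure D.  The filter
   within D (nbhs p) is not punctured, so at p in D its convergence says that
   the partial derivative is continuous at p. *)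
Record C1_upto (R : realType) (D E : set (R * R)) (f : R * R -> R) : Prop := {
  C1_differentiable : forall p, D p -> differentiable f p;
  C1_continuous : {within E, continuous f};
  C1_cvg_d1 : forall p, E p -> cvg (d1 f @ within D (nbhs p));
  C1_cvg_d2 : forall p, E p -> cvg (d2 f @ within D (nbhs p)) }.

(* Partial derivatives of a function that is C^1 up to the boundary of D. *)
Definition d1_upto (R : realType) (D : set (R * R)) (f : R * R -> R)
  (p : R * R) : R := lim (d1 f @ within D (nbhs p)).
Definition d2_upto (R : realType) (D : set (R * R)) (f : R * R -> R)
  (p : R * R) : R := lim (d2 f @ within D (nbhs p)).

Definition area (R : realType) :
    {measure set (measurableTypeR R * measurableTypeR R) -> \bar R} :=
  (@lebesgue_measure R \x @lebesgue_measure R)%E.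

Inductive side := minus | plus.

Record initial_data (R : realType) := InitialData {
  curveA : R -> R;
  curveB : R -> R;
  levelG : R * R -> R;
  dens0 : side -> R * R -> R;
  velu0 : side -> R * R -> R;
  velv0 : side -> R * R -> R }.

Section InitialData.
Context (R : realType) (d : initial_data R).

Definition curve : set (R * R) := range (fun l => (curveA d l, curveB d l)).

Definition region (j : side) : set (R * R) :=
  match j with
  | minus => [set p | levelG d p < 0]
  | plus => [set p | 0 < levelG d p]
  end.

(* The curve is Lebesgue-null, so the values chosen on it are irrelevant. *)
Definition two_sided (f : side -> R * R -> R) (p : R * R) : R :=
  if levelG d p < 0 then f minus p else f plus p.

Definition flux0 (j : side) (l : R) : R :=
  let p := (curveA d l, curveB d l) in
  derive1 (curveA d) l * velv0 d j p - derive1 (curveB d) l * velu0 d j p.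

Record admissible_data : Prop := {
  A_C1 : (forall l, derivable (curveA d) l 1) /\ continuous (derive1 (curveA d));
  B_C1 : (forall l, derivable (curveB d) l 1) /\ continuous (derive1 (curveB d));
  AB_monotone : forall l, 0 <= derive1 (curveA d) l /\ 0 <= derive1 (curveB d) l;
  AB_regular : forall l, (derive1 (curveA d) l) ^+ 2 + (derive1 (curveB d) l) ^+ 2 != 0;
  G_C1 : C1_upto setT setT (levelG d);
  curve_levelG : curve = [set p | levelG d p = 0];
  dens0_gt0 : forall j p, region j p -> 0 < dens0 d j p;
  dens0_C1 : forall j, C1_upto (region j) (closure (region j)) (dens0 d j);
  velu0_C1 : forall j, C1_upto (region j) (closure (region j)) (velu0 d j);
  velv0_C1 : forall j, C1_upto (region j) (closure (region j)) (velv0 d j);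
  flux0_minus : forall l, flux0 minus l < 0;
  flux0_plus : forall l, 0 < flux0 plus l }.

Definition charmap (j : side) (t : R) (p : R * R) : R * R :=
  (p.1 + t * velu0 d j p, p.2 + t * velv0 d j p).

(* The determinant of d(x, y) / d(a, b) for (x, y) = charmap j t (a, b). *)
Definition charjac (j : side) (t : R) (p : R * R) : R :=
  let D := region j in
  (1 + t * d1_upto D (velu0 d j) p) * (1 + t * d2_upto D (velv0 d j) p)
  - (t * d2_upto D (velu0 d j) p) * (t * d1_upto D (velv0 d j) p).

Record small_time (T : R) : Prop := {
  charmap_nondegenerate : forall j t, 0 <= t < T ->
    exists N : set (R * R), [/\ open N, curve `<=` N &
      forall p, N p -> closure (region j) p -> charjac j t p != 0];
  charmap_noncrossing : forall j t, 0 <= t < T ->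
    {in closure (region j) &, injective (charmap j t)} }.

End InitialData.

Section GeneralizedSolution.
Context (R : realType).

Definition test_fun (f : R * R -> R) : Prop :=
  C1_upto setT setT f /\
  exists2 K : set (R * R), compact K & forall p, ~ K p -> f p = 0.

Context (T : R) (P : R -> {measure set (R * R) -> \bar R})
  (u v : R -> R * R -> R).

(* The transport equation for the measures g t * P t, with initial value the
   measure of density g0; for g = 1, u, v these are P t, I t and J t. *)
Record transported (g : R -> R * R -> R) (g0 : R * R -> R) : Prop := {
  transport_integrable : forall f, test_fun f ->
    forall t1 t2, 0 < t1 -> t1 <= t2 -> t2 < T ->
    (@lebesgue_measure R).-integrable `[t1, t2]
      (fun s => (\int[P s]_p
         (g s p * (u s p * d1 f p + v s p * d2 f p)))%:E);
  transport_eq : forall f, test_fun f ->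
    forall t1 t2, 0 < t1 -> t1 <= t2 -> t2 < T ->
    \int[P t2]_p (g t2 p * f p) - \int[P t1]_p (g t1 p * f p) =
    \int[@lebesgue_measure R]_(s in `[t1, t2])
      \int[P s]_p (g s p * (u s p * d1 f p + v s p * d2 f p));
  transport_init : forall f, test_fun f ->
    \int[P t]_p (g t p * f p) @[t --> 0^'+] -->
    \int[area R]_p (g0 p * f p) }.

(* Mass P t and momenta I t = u t * P t, J t = v t * P t: the absolute
   continuity of I t and J t with respect to P t is expressed by their
   densities, since these signed measures need not have finite total variation
   and so need not be charges. *)
Record generalized_solution (rho0 u0 v0 : R * R -> R) : Prop := {
  gs_radon : forall t K, 0 < t < T -> compact K -> (P t K < +oo)%E;
  gs_measurable_u : forall t, 0 < t < T -> measurable_fun setT (u t);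
  gs_measurable_v : forall t, 0 < t < T -> measurable_fun setT (v t);
  gs_energy : forall t K, 0 < t < T -> compact K ->
    (P t).-integrable K (fun p => ((u t p) ^+ 2 + (v t p) ^+ 2)%:E);
  gs_mass : transported (fun _ _ => 1) rho0;
  gs_momentum_u : transported u (fun p => rho0 p * u0 p);
  gs_momentum_v : transported v (fun p => rho0 p * v0 p) }.

End GeneralizedSolution.

Record shock_data (R : realType) := ShockData {
  (* sides of the surface, as subsets of (t, (x, y))-space *)
  sside : side -> set (R * (R * R));
  srho : side -> R -> R * R -> R;
  su : side -> R -> R * R -> R;
  sv : side -> R -> R * R -> R;
  (* the remaining functions take (t, l) as argument *)
  sx : R * R -> R;
  sy : R * R -> R;
  sP : R * R -> R;
  sI : R * R -> R;
  sJ : R * R -> R;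
  sa : side -> R * R -> R;
  sb : side -> R * R -> R }.

Section Shock.
Context (R : realType) (d : initial_data R) (T : R) (s : shock_data R).

Definition slice (j : side) (t : R) : set (R * R) := [set q | sside s j (t, q)].

Definition gamma (t l : R) : R * R := (sx s (t, l), sy s (t, l)).

Definition surface : set (R * (R * R)) :=
  [set z | 0 < z.1 < T /\ range (gamma z.1) z.2].

Definition foot (j : side) (t l : R) : R * R := (sa s j (t, l), sb s j (t, l)).

Definition strip : set (R * R) := [set z | 0 < z.1 < T].
Definition strip0 : set (R * R) := [set z | 0 <= z.1 < T].

(* The set function m (a possibly signed, locally finite measure at time t)
   has density r j on side j, and the surface carries a concentrated part of
   density c with respect to dl. *)
Definition shock_measure (t : R) (m : set (R * R) -> R)
    (r : side -> R * R -> R) (c : R -> R) : Prop :=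
  forall E : set (R * R), measurable E -> bounded_set E ->
  [/\ forall j, (area R).-integrable
        (slice j t `&` E) (EFin \o r j),
      (@lebesgue_measure R).-integrable (gamma t @^-1` E) (EFin \o c) &
      m E = \int[area R]_(q in slice minus t `&` E) r minus q
          + \int[area R]_(q in slice plus t `&` E) r plus q
          + \int[@lebesgue_measure R]_(l in gamma t @^-1` E) c l].

Record single_shock (P : R -> {measure set (R * R) -> \bar R})
    (u v : R -> R * R -> R) : Prop := {
  side_open : forall j, open (sside s j);
  side_disjoint : sside s minus `&` sside s plus = set0;
  side_surface : forall j, sside s j `&` surface = set0;
  side_cover :
    sside s minus `|` sside s plus `|` surface = [set z | 0 < z.1 < T];
  classical_cover : forall j t q, 0 < t < T -> slice j t q ->
    exists2 p, closure (region d j) p & charmap d j t p = q;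
  (* On the surface itself these are the limits from side j; the value there
     comes from the characteristic issued from foot j t l. *)
  classical_formula : forall j t p, 0 < t < T -> closure (region d j) p ->
    (slice j t `|` range (gamma t)) (charmap d j t p) ->
    let q := charmap d j t p in
    [/\ charjac d j t p != 0,
        srho s j t q = dens0 d j p / charjac d j t p,
        su s j t q = velu0 d j p &
        sv s j t q = velv0 d j p];
  mass_form : forall t, 0 < t < T ->
    shock_measure t (fun E => fine (P t E))
      (fun j => srho s j t) (fun l => sP s (t, l));
  momentum_u_form : forall t, 0 < t < T ->
    shock_measure t (fun E => \int[P t]_(q in E) u t q)
      (fun j q => srho s j t q * su s j t q) (fun l => sI s (t, l));
  momentum_v_form : forall t, 0 < t < T ->
    shock_measure t (fun E => \int[P t]_(q in E) v t q)
      (fun j q => srho s j t q * sv s j t q) (fun l => sJ s (t, l));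
  sP_C1 : C1_upto strip strip (sP s);
  sI_C1 : C1_upto strip strip (sI s);
  sJ_C1 : C1_upto strip strip (sJ s);
  sa_C1 : forall j, C1_upto strip strip0 (sa s j);
  sb_C1 : forall j, C1_upto strip strip0 (sb s j);
  foot_region : forall j t l, 0 <= t < T -> closure (region d j) (foot j t l);
  foot_gamma : forall j t l, 0 <= t < T -> charmap d j t (foot j t l) = gamma t l }.

Definition Ush (t l : R) : R := sI s (t, l) / sP s (t, l).
Definition Vsh (t l : R) : R := sJ s (t, l) / sP s (t, l).

Definition Mfoot (j : side) (t l : R) : R :=
  d1 (sa s j) (t, l) * d2 (sb s j) (t, l)
  - d1 (sb s j) (t, l) * d2 (sa s j) (t, l).

(* The values at the single instant tau = 0, where d1 and d2 are taken outside
   the strip, do not affect the integral. *)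
Definition inflow (g : side -> R * R -> R) (t l : R) : R :=
  \int[@lebesgue_measure R]_(tau in `[0, t])
    (g plus (foot plus tau l) * Mfoot plus tau l
     - g minus (foot minus tau l) * Mfoot minus tau l).

Record shock_formulas : Prop := {
  gamma_init : forall l, gamma 0 l = (curveA d l, curveB d l);
  gamma_dx : forall t l, 0 < t < T ->
    is_derive ((t, l) : R * R) ((1, 0) : R * R) (sx s) (Ush t l);
  gamma_dy : forall t l, 0 < t < T ->
    is_derive ((t, l) : R * R) ((1, 0) : R * R) (sy s) (Vsh t l);
  sP_formula : forall t l, 0 <= t < T ->
    sP s (t, l) = inflow (dens0 d) t l;
  sI_formula : forall t l, 0 <= t < T ->
    sI s (t, l) = inflow (fun j p => dens0 d j p * velu0 d j p) t l;
  sJ_formula : forall t l, 0 <= t < T ->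
    sJ s (t, l) = inflow (fun j p => dens0 d j p * velv0 d j p) t l }.

End Shock.

(* Main.v *)
Require Import Defs.
From HB Require Import structures.
From mathcomp Require Import all_boot all_order all_algebra.
From mathcomp Require Import all_classical all_reals all_analysis.
From mathcomp Require Import ring lra.

Set Implicit Arguments.
Unset Strict Implicit.
Unset Printing Implicit Defensive.

Import Order.TTheory GRing.Theory Num.Theory.
Import numFieldNormedType.Exports.

Local Open Scope classical_set_scope.
Local Open Scope ring_scope.

(* The initial positions [a_j, b_j] of the characteristics ending on the shock may
   lie on the initial curve, where the velocities are only C^1 up to the boundary.
   The monotonicity of the curve makes each region stable under translation by one
   of the cones [{(s, -r)}], [{(-s, r)}] with [s, r >= 0]; in such a domain C^1
   regularity up to the boundary gives first order expansions at the boundary, and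
   hence a chain rule along the shock.  Differentiating
   [x = a_j + t u_j(a_j, b_j)], [y = b_j + t v_j(a_j, b_j)] in [t] and [l] then gives
   [J M_j = (U - u_j) y_l - (V - v_j) x_l], with [J] the Jacobian of the
   characteristic map.  As [rho_j J] is the initial density, the integrand in the
   formulas for P, I and J is the jump of [rho_j ((U - u_j) y_l - (V - v_j) x_l)]
   times [1], [u_j] or [v_j], and the system follows by differentiating the
   integrals. *)

(** * Partial derivatives and first order expansion up to the boundary *)

Section Calculus.
Context (R : realType).
Implicit Types (D E : set (R * R)) (f : R * R -> R) (p q v w : R * R).

(** The difference quotients agree as functions of [h], before any limit, so derivability and the
    value of the derivative transfer together by rewriting. *)
Lemma derive_fstE f (t l : R) :
  (fun h : R => h^-1 *: ((f \o shift (t, l)) (h *: ((1, 0) : R * R)) - f (t, l)))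
  = (fun h : R => h^-1 *: (((fun a => f (a, l)) \o shift t) (h *: (1 : R)) - f (t, l))).
Proof.
apply/funext => h /=; congr (_ *: (f _ - _)).
by rewrite /shift /=; congr pair => /=; rewrite scaler0 add0r.
Qed.

Lemma derive_sndE f (t l : R) :
  (fun h : R => h^-1 *: ((f \o shift (t, l)) (h *: ((0, 1) : R * R)) - f (t, l)))
  = (fun h : R => h^-1 *: (((fun a => f (t, a)) \o shift l) (h *: (1 : R)) - f (t, l))).
Proof.
apply/funext => h /=; congr (_ *: (f _ - _)).
by rewrite /shift /=; congr pair => /=; rewrite scaler0 add0r.
Qed.

Lemma is_derive_fst f (t l df : R) :
  is_derive ((t, l) : R * R) ((1, 0) : R * R) f df <->
  is_derive t 1 (fun a => f (a, l)) df.
Proof.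
by split=> -[ex de]; apply: DeriveDef; move: ex de;
  rewrite /derivable /derive derive_fstE.
Qed.

Lemma is_derive_snd f (t l df : R) :
  is_derive ((t, l) : R * R) ((0, 1) : R * R) f df <->
  is_derive l 1 (fun a => f (t, a)) df.
Proof.
by split=> -[ex de]; apply: DeriveDef; move: ex de;
  rewrite /derivable /derive derive_sndE.
Qed.

Lemma derive_partials f p v : differentiable f p ->
  'D_v f p = v.1 * d1 f p + v.2 * d2 f p.
Proof.
move=> df; rewrite /d1 /d2 !deriveE//.
have -> : v = v.1 *: ((1, 0) : R * R) + v.2 *: ((0, 1) : R * R).
  case: v => a b /=; congr pair => /=.
    by rewrite scaler0 addr0 /GRing.scale /= mulr1.
  by rewrite scaler0 add0r /GRing.scale /= mulr1.
rewrite linearD !linearZ /= !scaler0 /GRing.scale /= !mulr1.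
by rewrite addr0 add0r.
Qed.

Lemma is_derive_line f p v (x : R) : differentiable f (p + x *: v) ->
  is_derive x 1 (fun y => f (p + y *: v))
    (v.1 * d1 f (p + x *: v) + v.2 * d2 f (p + x *: v)).
Proof.
move=> df; rewrite -(derive_partials v df).
have := derivableP (diff_derivable (v := v) df).
set g := fun y => _.
have gE : (fun h : R => h^-1 *: ((f \o shift (p + x *: v)) (h *: v) - f (p + x *: v)))
  = (fun h : R => h^-1 *: ((g \o shift x) (h *: (1 : R)) - g x)).
  apply/funext => h /=; congr (_ *: (f _ - _)).
  rewrite /shift /= addrCA; congr (_ + _).
  by rewrite -[h *: 1]/(h * 1) mulr1 scalerDl.
by move=> -[ex de]; apply: DeriveDef; move: ex de;
  rewrite /derivable /derive gE.
Qed.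

Lemma continuous_within_comp (T U V : topologicalType) (A : set T) (E : set U)
    (f : U -> V) (g : T -> U) :
  {within E, continuous f} -> {within A, continuous g} ->
  (forall x, A x -> E (g x)) -> {within A, continuous (f \o g)}.
Proof.
move=> /subspace_continuousP cf /subspace_continuousP cg AE.
apply/subspace_continuousP => x Ax.
apply: cvg_comp (cf _ (AE _ Ax)).
move=> S /= /(cg _ Ax); rewrite /nbhs /= /within /= => H.
near=> y => Ay; have := AE _ Ay; move: Ay; near: y.
exact: H.
Unshelve. all: by end_near. Qed.

(** Mean value theorem for [f] minus its linear model along the segment. Only the open segment has
    to lie in [D]; at the end points continuity suffices, so these may be boundary points. *)
Lemma segment_expansion D E f p v (g1 g2 e : R) :
  (forall x : R, 0 <= x <= 1 -> E (p + x *: v)) ->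
  (forall x : R, 0 < x < 1 -> D (p + x *: v)) ->
  {within E, continuous f} -> (forall q, D q -> differentiable f q) ->
  (forall x : R, 0 < x < 1 ->
    `|d1 f (p + x *: v) - g1| <= e /\ `|d2 f (p + x *: v) - g2| <= e) ->
  `|f (p + v) - f p - (g1 * v.1 + g2 * v.2)| <= e * (`|v.1| + `|v.2|).
Proof.
move=> pE pD cf df he.
pose F x := f (p + x *: v) - x * (g1 * v.1 + g2 * v.2).
pose dF x := v.1 * d1 f (p + x *: v) + v.2 * d2 f (p + x *: v)
  - (g1 * v.1 + g2 * v.2).
have F' (x : R) : x \in `]0, 1[ -> is_derive x 1 F (dF x).
  rewrite in_itv /= => x01.
  have := is_derive_line (df _ (pD _ x01)) => H.
  have H2 : is_derive x 1 (fun x : R => x * (g1 * v.1 + g2 * v.2)) (g1 * v.1 + g2 * v.2).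
    apply: is_derive_eq.
    by rewrite scaler0 add0r /GRing.scale /= mulr1.
  exact: is_deriveB.
have cF : {within `[0, 1], continuous F}.
  have c1 : {within `[0, 1], continuous (fun x : R => f (p + x *: v))}.
    apply: (@continuous_within_comp _ _ _ _ E f (fun x : R => p + x *: v)) => //.
    apply: continuous_subspaceT => x.
    by apply: cvgD; [exact: cvg_cst|exact: cvgZl].
  have c2 : {within `[0, 1], continuous (fun x : R => x * (g1 * v.1 + g2 * v.2))}.
    by apply: continuous_subspaceT => x; apply: cvgMl.
  by move=> x; apply: cvgB; [exact: c1|exact: c2].
have [c c01 cE] := MVT ltr01 F' cF.
move: c01; rewrite in_itv /= => /he[e1 e2].
move: cE; rewrite /F scale0r scale1r addr0 mul0r !subr0 mul1r mulr1 addrAC => ->.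
rewrite (_ : dF c = (d1 f (p + c *: v) - g1) * v.1 + (d2 f (p + c *: v) - g2) * v.2).
  apply: le_trans (ler_normD _ _) _; rewrite !normrM mulrDr.
  by apply: lerD; apply: ler_wpM2r.
by rewrite /dF; ring.
Qed.

Lemma near_squareP p (Q : R * R -> Prop) : (\forall q \near p, Q q) <->
  exists2 e : R, 0 < e & forall q, `|q.1 - p.1| < e -> `|q.2 - p.2| < e -> Q q.
Proof.
split=> [[[A B] /= [/nbhs_ballP[e e0 eA] /nbhs_ballP[e' e'0 eB]] AB]|[e e0 eQ]].
  exists (Num.min e e'); first by rewrite lt_min e0.
  move=> q; rewrite !lt_min => /andP[q1 _] /andP[_ q2].
  by apply: AB; split => /=; [apply: eA|apply: eB]; rewrite /ball /= distrC.
exists (ball p.1 e, ball p.2 e); first by split; exact: nbhsx_ballx.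
by move=> q /= []; rewrite /ball /= => q1 q2; apply: eQ; rewrite distrC.
Qed.

(** The cone is the lower right quadrant for [c = 1] and the upper left one for [c = -1]: the
    directions that lead away from a nondecreasing curve. *)
Definition cone_closed (c : R) D := forall p (s r : R), D p -> 0 <= s -> 0 <= r ->
  D (p.1 + c * s, p.2 - c * r).

(** A point [q] of [D] closer to [p] than [s] and [r] still has the target in its cone, since the
    coordinates of [p - q] are absorbed by the positive [s] and [r]. *)
Lemma closure_cone (c : R) D p (s r : R) : c = 1 \/ c = -1 -> cone_closed c D ->
  closure D p -> 0 < s -> 0 < r -> D (p.1 + c * s, p.2 - c * r).
Proof.
move=> c1 cD clp s0 r0.
have m0 : 0 < Num.min s r by rewrite lt_min s0 r0.
have [q [Dq]] := clp _ (nbhsx_ballx p _ m0).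
rewrite /ball /= /prod_ball /ball /= !lt_min => -[/andP[h1 _] /andP[_ h2]].
have -> : (p.1 + c * s, p.2 - c * r) =
    (q.1 + c * (s + c * (p.1 - q.1)), q.2 - c * (r - c * (p.2 - q.2))).
  by congr pair; case: c1 => ->; ring.
by apply: cD => //; move: h1 h2; rewrite !ltr_norml => /andP[? ?] /andP[? ?];
  case: c1 => ->; lra.
Qed.

(* A detour through [w], on the cone axis of [p0], joins [p0] to [p] by two
   segments that lie in [D] except for their end points. *)
Lemma C1_upto_expansion (c : R) D f p0 (e : R) : c = 1 \/ c = -1 -> cone_closed c D ->
  C1_upto D (closure D) f -> closure D p0 -> 0 < e ->
  \forall p \near p0, closure D p ->
    `|f p - f p0 - (d1_upto D f p0 * (p.1 - p0.1) + d2_upto D f p0 * (p.2 - p0.2))|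
    <= e * (`|p.1 - p0.1| + `|p.2 - p0.2|).
Proof.
move=> c1 cD [df cf cv1 cv2] clp0 e0.
(* Each of the two segments will cost [e / 12 * (6 * n)], with [n] the sum of the coordinate
   distances from [p0] to [p]; together this is [e * n]. *)
have e10 : 0 < e / 12 by apply: divr_gt0.
have h1 : \forall q \near p0, D q -> `|d1_upto D f p0 - d1 f q| <= e / 12.
  exact: ((cvgrPdist_le _ _).1 (cv1 _ clp0) _ e10).
have h2 : \forall q \near p0, D q -> `|d2_upto D f p0 - d2 f q| <= e / 12.
  exact: ((cvgrPdist_le _ _).1 (cv2 _ clp0) _ e10).
move: (d1_upto D f p0) (d2_upto D f p0) h1 h2 => g1 g2 h1 h2.
have /near_squareP[dl dl0 hdl] : \forall q \near p0, D q ->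
    `|d1 f q - g1| <= e / 12 /\ `|d2 f q - g2| <= e / 12.
  move/near_squareP : h1 => [r1 r10 k1]; move/near_squareP : h2 => [r2 r20 k2].
  apply/near_squareP; exists (Num.min r1 r2); first by rewrite lt_min r10.
  move=> q; rewrite !lt_min => /andP[a1 a2] /andP[b1 b2] Dq.
  have {k1} k1 : `|g1 - d1 f q| <= e / 12 := k1 q a1 b1 Dq.
  have {k2} k2 : `|g2 - d2 f q| <= e / 12 := k2 q a2 b2 Dq.
  split; first by rewrite distrC; exact: k1.
  by rewrite distrC; exact: k2.
(* Both segments stay within [2 * n] of [p0] in each coordinate, and the radius [dl / 4] gives
   [2 * n < dl]. *)
have dl4 : 0 < dl / 4 by apply: divr_gt0.
apply/near_squareP; exists (dl / 4) => // p b1 b2 clp.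
set n := `|p.1 - p0.1| + `|p.2 - p0.2|.
have n0 : 0 <= n by rewrite addr_ge0.
have nd : 2 * n < dl by rewrite /n; lra.
have n1 : `|p.1 - p0.1| <= n by rewrite lerDl.
have n2 : `|p.2 - p0.2| <= n by rewrite lerDr.
have /andP[{}n1 n1'] : - n <= p.1 - p0.1 <= n by rewrite -ler_norml.
have /andP[{}n2 n2'] : - n <= p.2 - p0.2 <= n by rewrite -ler_norml.
have [n_eq0|n_neq0] := eqVneq n 0.
  rewrite n_eq0 in n1 n1' n2 n2' *.
  have <- : p0 = p.
    by case: (p) (p0) n1 n1' n2 n2' => ? ? [? ?] /= *; congr pair; lra.
  by rewrite !subrr !mulr0 addr0 subr0 normr0.
have {n_neq0}n_gt0 : 0 < n by rewrite lt0r n_neq0.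
(* The length [2 * n] exceeds the coordinates of [p - p0], so [w] lies in the open cone of [p] as
   well as in that of [p0]. *)
pose w : R * R := (p0.1 + c * (2 * n), p0.2 - c * (2 * n)).
have seg q : closure D q -> `|q.1 - p0.1| <= n -> `|q.2 - p0.2| <= n ->
    `|f w - f q - (g1 * (w.1 - q.1) + g2 * (w.2 - q.2))| <= e / 12 * (6 * n).
  move=> clq; rewrite ler_norml => /andP[q1 q1']; rewrite ler_norml => /andP[q2 q2'].
  have qE (x : R) : q + x *: (w - q) =
      (q.1 + c * (x * (2 * n - c * (q.1 - p0.1))),
       q.2 - c * (x * (2 * n + c * (q.2 - p0.2)))).
    by case: q {clq q1 q1' q2 q2'} => ? ? /=; congr pair => /=;
      rewrite /w /= /GRing.scale /=; case: c1 => ->; ring.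
  have qD (x : R) : 0 < x -> D (q + x *: (w - q)).
    move=> x0; rewrite qE; apply: (closure_cone c1 cD clq);
      apply: mulr_gt0 => //; case: c1 => ->; lra.
  have := @segment_expansion D (closure D) f q (w - q) g1 g2 (e / 12).
  rewrite [q + (w - q)]addrC subrK => H.
  apply: le_trans; first apply: H => //.
  - move=> x /andP[]; rewrite le_eqVlt => /orP[/eqP<- _|x0 _].
      by rewrite scale0r addr0.
    by apply: subset_closure; exact: qD.
  - by move=> x /andP[x0 _]; exact: qD.
  - move=> x /andP[x0 x1]; have y0 : 0 < 1 - x by rewrite subr_gt0.
    have k0 : 0 < (1 - x) * n by rewrite mulr_gt0.
    have k0' : 0 < x * n by rewrite mulr_gt0.
    have k1 : 0 <= (1 - x) * (n - (q.1 - p0.1))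
      by apply: mulr_ge0; [exact: ltW|lra].
    have k2 : 0 <= (1 - x) * (n + (q.1 - p0.1)).
      by apply: mulr_ge0; [exact: ltW|lra].
    have k3 : 0 <= (1 - x) * (n - (q.2 - p0.2))
      by apply: mulr_ge0; [exact: ltW|lra].
    have k4 : 0 <= (1 - x) * (n + (q.2 - p0.2)).
      by apply: mulr_ge0; [exact: ltW|lra].
    apply: hdl; last exact: qD.
      rewrite qE /= ltr_norml; case: c1 => ->; apply/andP; split; lra.
    rewrite qE /= ltr_norml; case: c1 => ->; apply/andP; split; lra.
  - apply: ler_wpM2l; first exact: ltW.
    have -> : 6 * n = 3 * n + 3 * n by ring.
    rewrite /w; apply: lerD; rewrite ler_norml /=; case: c1 => ->;
      apply/andP; split; lra.
have s0 : `|f w - f p0 - (g1 * (w.1 - p0.1) + g2 * (w.2 - p0.2))| <= e / 12 * (6 * n).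
  by apply: seg => //; rewrite subrr normr0.
have s1 : `|f w - f p - (g1 * (w.1 - p.1) + g2 * (w.2 - p.2))| <= e / 12 * (6 * n).
  by apply: seg => //; rewrite ler_norml; apply/andP; split.
(* Both expansions use the same coefficients [g1] and [g2], so [w] drops out of their difference. *)
have -> : f p - f p0 - (g1 * (p.1 - p0.1) + g2 * (p.2 - p0.2)) =
  (f w - f p0 - (g1 * (w.1 - p0.1) + g2 * (w.2 - p0.2))) -
  (f w - f p - (g1 * (w.1 - p.1) + g2 * (w.2 - p.2))) by ring.
apply: le_trans (ler_normB _ _) _.
apply: le_trans (lerD s0 s1) _.
by rewrite le_eqVlt; apply/orP; left; apply/eqP; field.
Qed.

End Calculus.

(** * Chain rule along a path in the closure of a domain *)

Lemma is_derive1P (R : realType) (f : R -> R) (x df : R) :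
  is_derive x 1 f df <-> h^-1 * (f (h + x) - f x) @[h --> 0^'] --> df.
Proof.
have E : (fun h : R => h^-1 *: ((f \o shift x) (h *: (1 : R)) - f x)) =
    (fun h => h^-1 * (f (h + x) - f x)).
  by apply/funext => h /=; rewrite /shift /= -[h *: 1]/(h * 1) mulr1.
split=> [[]|H].
  by rewrite /derivable /derive E => ex <-.
apply: DeriveDef; rewrite /derivable /derive E; first exact: cvgP H.
exact: cvg_lim H.
Qed.

Lemma cvg_shift_dnbhs (R : realType) (x : R) : h + x @[h --> (0 : R)^'] --> x.
Proof.
have H : h + x @[h --> (0 : R)] --> 0 + x by apply: cvgD; [exact: cvg_id|exact: cvg_cst].
by rewrite add0r in H; apply: cvg_trans H; apply: cvg_app; exact: cvg_within.
Qed.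

(** The path may touch the boundary, where [f] need not be differentiable in the plane. The
    expansion relative to the closure still makes the remainder [r] small compared with [h], and the
    linear part has the expected limit. *)
Lemma is_derive_comp_upto (R : realType) (c : R) (D : set (R * R)) (f : R * R -> R)
    (a b : R -> R) (x da db : R) : c = 1 \/ c = -1 -> cone_closed c D ->
  C1_upto D (closure D) f -> is_derive x 1 a da -> is_derive x 1 b db ->
  (\forall y \near x, closure D (a y, b y)) ->
  is_derive x 1 (fun y => f (a y, b y))
    (d1_upto D f (a x, b x) * da + d2_upto D f (a x, b x) * db).
Proof.
move=> c1 cD fD a' b' nD.
have clx : closure D (a x, b x) := nbhs_singleton nD.
have ex e := C1_upto_expansion (e := e) c1 cD fD clx.
have cvx (g : R -> R) dg : is_derive x 1 g dg -> g (h + x) @[h --> 0^'] --> g x.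
  move=> [dg' _].
  have cg : {for x, continuous g} by apply/differentiable_continuous/derivable1_diffP.
  exact: (@cvg_comp _ _ _ (fun h => h + x) g _ _ _ (cvg_shift_dnbhs (x := x)) cg).
have ca := cvx _ _ a'; have cb := cvx _ _ b'.
move/is_derive1P : a' => a'; move/is_derive1P : b' => b'.
apply/is_derive1P.
move: (d1_upto D f (a x, b x)) (d2_upto D f (a x, b x)) ex => g1 g2 ex.
pose r (y : R) := f (a y, b y) - f (a x, b x) - (g1 * (a y - a x) + g2 * (b y - b x)).
have rE : (fun h => h^-1 * (f (a (h + x), b (h + x)) - f (a x, b x))) =
    (fun h => h^-1 * r (h + x) + (g1 * (h^-1 * (a (h + x) - a x)) +
      g2 * (h^-1 * (b (h + x) - b x)))).
  by apply/funext => h; rewrite /r; ring.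
rewrite rE -[g1 * da + _]add0r; apply: cvgD; last first.
  by apply: cvgD; apply: cvgMr.
apply/cvgrPdist_le => e e0.
(* Eventual bound for the two difference quotients together; the added 1 leaves room above their
   limit and makes [K] positive. *)
pose K := `|da| + `|db| + 1.
have K0 : 0 < K by rewrite ltr_wpDl.
have eK : 0 < e / K by rewrite divr_gt0.
have nK : \forall h \near 0^', `|h^-1 * (a (h + x) - a x)| + `|h^-1 * (b (h + x) - b x)| < K.
  have /cvgr_lt : `|h^-1 * (a (h + x) - a x)| + `|h^-1 * (b (h + x) - b x)|
     @[h --> 0^'] --> `|da| + `|db| by apply: cvgD; apply: cvg_norm.
  by apply; rewrite ltrDl.
have nx : \forall h \near (0 : R)^', closure D (a (h + x), b (h + x)).
  exact: (cvg_shift_dnbhs nD).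
have [dl dl0 hdl] := (near_squareP _ _).1 (ex _ eK).
have na : \forall h \near 0^', `|a (h + x) - a x| < dl.
  move/cvgrPdist_lt : ca => /(_ _ dl0); apply: filterS => h.
  by rewrite distrC.
have nb : \forall h \near 0^', `|b (h + x) - b x| < dl.
  move/cvgrPdist_lt : cb => /(_ _ dl0); apply: filterS => h.
  by rewrite distrC.
near=> h.
rewrite sub0r normrN normrM.
have hK : `|h^-1 * (a (h + x) - a x)| + `|h^-1 * (b (h + x) - b x)| < K by near: h.
have ha : `|a (h + x) - a x| < dl by near: h.
have hb : `|b (h + x) - b x| < dl by near: h.
have hD : closure D (a (h + x), b (h + x)) by near: h.
have := hdl (_, _) ha hb hD; rewrite /= -/(r (h + x)) => rle.
apply: le_trans (ler_wpM2l (normr_ge0 _) rle) _.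
rewrite mulrCA mulrDr -!normrM -mulrA mulrCA ler_pdivrMl// (mulrC K).
by apply: ler_wpM2l; exact: ltW.
Unshelve. all: by end_near. Qed.

(** * The two sides of a monotone curve and their cones *)

Lemma derive1_ge0_homo (R : realType) (f : R -> R) :
  (forall x, derivable f x 1) -> (forall x, 0 <= derive1 f x) ->
  {homo f : x y / x <= y}.
Proof.
move=> df f0 x y xy; apply: (@ger0_derive1_ndecr R f x y) => //.
by apply: derivable_within_continuous.
Qed.

Lemma derive1_gt0_homo (R : realType) (f : R -> R) :
  (forall x, derivable f x 1) -> (forall x, 0 < derive1 f x) ->
  {homo f : x y / x < y}.
Proof.
move=> df f0 x y xy; apply: (@gtr0_derive1_lt_cc R f x y) => //.
- by apply: derivable_within_continuous.
- by rewrite in_itv /= lexx ltW.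
- by rewrite in_itv /= lexx ltW.
Qed.

(** Intermediate value theorem along the segment. Equality of signs is expressed by a positive
    product, which treats both signs at once. *)
Lemma nonzero_segment (R : realType) (G : R * R -> R) (p q : R * R) :
  continuous G -> (forall x : R, 0 <= x <= 1 -> G (p + x *: (q - p)) != 0) ->
  0 < G p * G q.
Proof.
move=> cG Gn0; rewrite ltNge; apply/negP => Gpq.
have cF : {within `[0, 1], continuous (fun x : R => G (p + x *: (q - p)))}.
  apply: continuous_subspaceT => x.
  apply: (@continuous_comp _ _ _ (fun x : R => p + x *: (q - p)) G); last exact: cG.
  by apply: cvgD; [exact: cvg_cst|exact: cvgZl].
have [] := IVT (v := 0) ler01 cF.
  rewrite scale0r addr0 scale1r addrC subrK ge_min le_max.
  have [p0|p0|_] := ltgtP (G p) 0; last by [].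
    have [//|q0] := leP 0 (G q).
    by have : 0 < G p * G q; [rewrite nmulr_lgt0|rewrite ltNge Gpq].
  have [//|q0] := leP (G q) 0.
  by have := mulr_gt0 p0 q0; rewrite ltNge Gpq.
by move=> x; rewrite in_itv /= => /Gn0 /eqP.
Qed.

Lemma continuous_cvg_pair (R : realType) (T : Type) (F : set_system T) (FF : Filter F)
    (f g : T -> R) (G : R * R -> R) (a b : R) :
  f x @[x --> F] --> a -> g x @[x --> F] --> b -> continuous G ->
  G (f x, g x) @[x --> F] --> G (a, b).
Proof.
move=> fa gb cG.
have H : (f x, g x) @[x --> F] --> ((a, b) : R * R) by exact: cvg_pair fa gb.
exact: (continuous_cvg _ (cG _) H).
Qed.

Section MonotoneCurve.
Context (R : realType) (A B : R -> R) (G : R * R -> R).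
Hypothesis A_ndecr : {homo A : x y / x <= y}.
Hypothesis B_ndecr : {homo B : x y / x <= y}.
Hypothesis AB_incr : forall x y, x < y -> A x + B x < A y + B y.
Hypothesis G_cont : continuous G.
Hypothesis G_curve : forall p, G p = 0 <-> exists l, p = (A l, B l).

(* Otherwise the curve would converge, and its limit would lie on the closed
   set [G = 0] without being a point of the curve. *)
Lemma monotone_curve_unbounded (c : R) : exists l, c <= A l + B l.
Proof.
apply: contrapT => H.
have H' l : A l + B l < c.
  by rewrite ltNge; apply/negP => Hl; apply: H; exists l.
(* If the sum is bounded above, then so is each coordinate on the integers, because the other one
   stays above its value at 0. *)
have ub (f g : R -> R) : {homo f : x y / x <= y} -> {homo g : x y / x <= y} ->
    (forall l, f l + g l < c) ->
    (f n%:R @[n --> \oo] --> sup (range (fun n : nat => f n%:R))) /\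
    forall n : nat, f n%:R <= sup (range (fun n : nat => f n%:R)).
  move=> f_nd g_nd fg.
  have bf : has_ubound (range (fun n : nat => f n%:R)).
    exists (c - g 0) => _ [n _ <-].
    by have := fg n%:R; have := g_nd 0 n%:R (ler0n _ _); lra.
  split; first by apply: nondecreasing_cvgn => // m n mn; apply: f_nd; rewrite ler_nat.
  by move=> n; apply: ub_le_sup => //; exists n.
have [cA leA] := ub A B A_ndecr B_ndecr H'.
have [cB leB] : (B n%:R @[n --> \oo] --> sup (range (fun n : nat => B n%:R))) /\
    forall n : nat, B n%:R <= sup (range (fun n : nat => B n%:R)).
  by apply: (ub B A) => // l; rewrite addrC.
move: (sup _) (sup _) cA leA cB leB => b a cA leA cB leB.
have Gab : G (a, b) = 0.
  have H1 := continuous_cvg_pair _ cA cB G_cont.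
  have H2 : G (A n%:R, B n%:R) @[n --> \oo] --> (0 : R).
    rewrite (_ : (fun n : nat => _) = fun=> 0); first exact: cvg_cst.
    by apply/funext => n; apply/G_curve; exists n%:R.
  have P : ProperFilter (\oo : set_system nat) by exact: eventually_filter.
  have FF : Filter (\oo : set_system nat) by exact: _.
  exact: (cvg_unique (@Rhausdorff R) (H1 FF) H2).
have [l [al bl]] := (G_curve _).1 Gab.
(* At [l] the sum of the coordinates already equals the limit [a + b], yet beyond [l] it is strictly
   larger. *)
have [n ln] : exists n : nat, l < n%:R.
  by exists (Num.bound `|l|); apply: le_lt_trans (ler_norm l) (archi_boundP (normr_ge0 l)).
by have := AB_incr ln; have := leA n; have := leB n; rewrite al bl; lra.
Qed.

End MonotoneCurve.

Section CurveSides.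
Context (R : realType) (A B : R -> R) (G : R * R -> R).
Hypothesis A_ndecr : {homo A : x y / x <= y}.
Hypothesis B_ndecr : {homo B : x y / x <= y}.
Hypothesis AB_incr : forall x y, x < y -> A x + B x < A y + B y.
Hypothesis A_cont : continuous A.
Hypothesis B_cont : continuous B.
Hypothesis G_cont : continuous G.
Hypothesis G_curve : forall p, G p = 0 <-> exists l, p = (A l, B l).

(** The sum is unbounded above, and unbounded below by the same result for the curve reflected
    through the origin; the intermediate value theorem does the rest. Thus the curve meets every
    antidiagonal. *)
Lemma monotone_curve_onto (c : R) : exists l, A l + B l = c.
Proof.
have [l2 cl2] := monotone_curve_unbounded A_ndecr B_ndecr AB_incr G_cont G_curve c.
have [l1 cl1] : exists l, - c <= - A (- l) + - B (- l).
  apply: (@monotone_curve_unbounded R (fun l => - A (- l)) (fun l => - B (- l))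
    (fun p => G (- p))).
  - by move=> x y xy; rewrite lerN2; apply: A_ndecr; rewrite lerN2.
  - by move=> x y xy; rewrite lerN2; apply: B_ndecr; rewrite lerN2.
  - by move=> x y xy; rewrite -!opprD ltrN2; apply: AB_incr; rewrite ltrN2.
  - move=> p; apply: (@continuous_comp _ _ _ (fun p : R * R => - p) G); last exact: G_cont.
    exact: opp_continuous.
  - move=> p; split=> [/G_curve[l pl]|[l ->]].
      by exists (- l); rewrite opprK -[p]opprK pl.
    by apply/G_curve; exists (- l); congr pair; rewrite /= opprK.
have l12 : - l1 <= l2.
  rewrite leNgt; apply/negP => /AB_incr; lra.
have cAB : {within `[- l1, l2], continuous (fun l => A l + B l)}.
  by apply: continuous_subspaceT => x; apply: cvgD; [exact: A_cont|exact: B_cont].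
have [] := IVT (v := c) l12 cAB.
  by rewrite ge_min le_max cl2 orbT andbT; apply/orP; left; lra.
by move=> l _ <-; exists l.
Qed.

(* [below 1] is the lower right side of the curve, [below (-1)] the upper left
   one; both contain the curve. *)
Definition below (c : R) (p : R * R) :=
  exists l, c * A l <= c * p.1 /\ c * p.2 <= c * B l.

(** Compare [p] with the curve point on its antidiagonal: the two coordinate differences are
    opposite. *)
Lemma below_cover (c : R) p : c = 1 \/ c = -1 -> below c p \/ below (- c) p.
Proof.
move=> c1; have [l lE] := monotone_curve_onto (p.1 + p.2).
have [h|h] := leP (c * A l) (c * p.1); [left|right]; exists l.
  by split=> //; case: c1 h => ->; lra.
by case: c1 h => ->; lra.
Qed.

Lemma between (f : R -> R) (x y z : R) : continuous f -> x <= y ->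
  f x <= z <= f y -> exists2 l, x <= l <= y & f l = z.
Proof.
move=> cf xy /andP[h1 h2]; have [] := @IVT R f x y z xy.
- exact: continuous_subspaceT.
- by rewrite ge_min le_max h1 h2 orbT.
by move=> l; rewrite in_itv; exists l.
Qed.

(** The inequalities at [l1] and [l2] force one of [A], [B] to take the same value at both
    parameters, hence to be constant between them by monotonicity; the other one attains the
    remaining coordinate of [p] there. *)
Lemma below_both p : below 1 p -> below (- 1) p -> G p = 0.
Proof.
move=> [l1 [h1 h2]] [l2 [h3 h4]]; apply/G_curve.
have [l12|/ltW l21] := leP l1 l2.
  have := B_ndecr l12 => hB.
  have [] := @between A l1 l2 p.1 A_cont l12; first by apply/andP; split; lra.
  move=> l /andP[la lb] lE; exists l; have := B_ndecr la; have := B_ndecr lb.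
  move=> ? ?; case: p lE h1 h2 h3 h4 => a b /= -> *; congr pair; lra.
have := A_ndecr l21 => hA.
have [] := @between B l2 l1 p.2 B_cont l21; first by apply/andP; split; lra.
move=> l /andP[la lb] lE; exists l; have := A_ndecr la; have := A_ndecr lb.
move=> ? ?; case: p lE h1 h2 h3 h4 => a b /= -> *; congr pair; lra.
Qed.

Lemma below_opp (c : R) p : c = 1 \/ c = -1 -> below c p -> below (- c) p -> G p = 0.
Proof.
case=> ->; first exact: below_both.
by rewrite opprK => h1 h2; exact: below_both.
Qed.

(** A curve point in the cone of [p] would put [p] on the opposite side as well, hence on the
    curve. *)
Lemma below_neq0 (c : R) p s r : c = 1 \/ c = -1 -> below c p -> G p != 0 ->
  0 <= s -> 0 <= r ->
  below c (p.1 + c * s, p.2 - c * r) /\ G (p.1 + c * s, p.2 - c * r) != 0.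
Proof.
move=> c1 bp Gp s0 r0; split.
  by case: bp => l [h1 h2]; exists l => /=; case: c1 h1 h2 => ->; lra.
apply/negP => /eqP/G_curve[l [e1 e2]]; move/eqP: Gp; apply.
apply: (below_opp c1 bp); exists l; rewrite -e1 -e2.
by case: c1 => ->; lra.
Qed.

Lemma below_same_sign (c : R) p s r : c = 1 \/ c = -1 -> below c p -> G p != 0 ->
  0 <= s -> 0 <= r -> 0 < G p * G (p.1 + c * s, p.2 - c * r).
Proof.
move=> c1 bp Gp s0 r0; apply: nonzero_segment => // x /andP[x0 _].
have -> : p + x *: ((p.1 + c * s, p.2 - c * r) - p) =
    (p.1 + c * (x * s), p.2 - c * (x * r)).
  by case: (p) => a b; congr pair => /=; rewrite /GRing.scale /=; ring.
by apply: (below_neq0 c1 bp Gp _ _).2; apply: mulr_ge0.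
Qed.

(** The cones of [p] and [q] share the point reached from [p] by [t], as [t] dominates both
    coordinate differences; [G] keeps its sign from each of them to that point. *)
Lemma below_sign (c : R) p q : c = 1 \/ c = -1 -> below c p -> below c q ->
  G p != 0 -> G q != 0 -> 0 < G p * G q.
Proof.
move=> c1 bp bq Gp Gq.
pose t := `|p.1 - q.1| + `|p.2 - q.2|.
have [t1 t2] : `|p.1 - q.1| <= t /\ `|p.2 - q.2| <= t.
  by rewrite /t lerDl lerDr.
move: t1 t2; rewrite !ler_norml => /andP[t1 t1'] /andP[t2 t2'].
have t0 : 0 <= t by rewrite addr_ge0.
have hp := below_same_sign c1 bp Gp t0 t0.
have := @below_same_sign c q (t + c * (p.1 - q.1)) (t - c * (p.2 - q.2)) c1 bq Gq.
have -> : (q.1 + c * (t + c * (p.1 - q.1)), q.2 - c * (t - c * (p.2 - q.2))) =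
    (p.1 + c * t, p.2 - c * t) by case: c1 => ->; congr pair; ring.
move=> hq; have {}hq := hq _ _.
have {hq} : 0 < G q * G (p.1 + c * t, p.2 - c * t).
  by apply: hq; case: c1 => ->; lra.
move: (G (_, _)) hp => w; move=> hp hq.
have : 0 < (G p * w) * (G q * w) by exact: mulr_gt0.
have -> : G p * w * (G q * w) = G p * G q * w ^+ 2 by ring.
have w2 : 0 <= w ^+ 2 by exact: sqr_ge0.
by move=> h; rewrite ltNge; apply/negP => h'; have := mulr_le0_ge0 h' w2; rewrite leNgt h.
Qed.

(** The point [p'] ensures that [G] changes sign across the curve; otherwise the set could be the
    whole complement of the curve. The orientation [c] is that of the side containing [p]. *)
Lemma side_cone p p' : G p * G p' < 0 ->
  exists2 c : R, c = 1 \/ c = -1 & cone_closed c [set q | 0 < G p * G q].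
Proof.
move=> pp'.
have Gp : G p != 0 by apply: contraTneq pp' => ->; rewrite mul0r ltxx.
have Gp' : G p' != 0 by apply: contraTneq pp' => ->; rewrite mulr0 ltxx.
have [c c1 bp] : exists2 c : R, c = 1 \/ c = -1 & below c p.
  by have [] := @below_cover 1 p (or_introl erefl); [exists 1|exists (-1)]; auto.
exists c => // q s r /= pq s0 r0.
have Gq : G q != 0 by apply: contraTneq pq => ->; rewrite mulr0 ltxx.
have bq : below c q.
  (* If [q] were on the other side, [p'] would share a side with [p] or with [q], although its sign
     is opposite to theirs. *)
  have [//|bq] := below_cover q c1.
  have [bp'|bp'] := below_cover p' c1.
    by have := below_sign c1 bp bp' Gp Gp'; rewrite ltNge (ltW pp').
  have c1' : - c = 1 \/ - c = -1 by case: c1 => ->; rewrite ?opprK; auto.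
  have := below_sign c1' bq bp' Gq Gp' => h.
  by exfalso; move: pp' pq h; nra.
have h := below_neq0 c1 bq Gq s0 r0.
exact: (below_sign c1 bp h.1 Gp h.2).
Qed.

End CurveSides.

Lemma region_cone (R : realType) (d : initial_data R) : admissible_data d ->
  (forall j, region d j !=set0) ->
  forall j, exists2 c : R, c = 1 \/ c = -1 & cone_closed c (region d j).
Proof.
move=> [[dA cA] [dB cB] mon reg [dG _ _ _] cG _ _ _ _ _ _] ne j.
have contD (f : R -> R) : (forall l, derivable f l 1) -> continuous f.
  by move=> df l; apply/differentiable_continuous/derivable1_diffP.
have G_curve p : levelG d p = 0 <-> exists l, p = (curveA d l, curveB d l).
  split=> [pG|[l pl]].
    have : curve d p by rewrite cG.
    by case=> l _ <-; exists l.
  suff : [set p | levelG d p = 0] p by [].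
  by rewrite -cG pl; exists l.
have G_cont : continuous (levelG d).
  by move=> p; apply: differentiable_continuous; exact: dG.
(* Both derivatives are nonnegative and they do not vanish together, so their sum is positive. *)
have AB_incr x y : x < y -> curveA d x + curveB d x < curveA d y + curveB d y.
  apply: (@derive1_gt0_homo R (fun l => curveA d l + curveB d l)).
    by move=> l; apply: derivableD.
  move=> l; rewrite derive1E deriveD// -!derive1E.
  have [a0 b0] := mon l; have := reg l.
  move: a0 b0; rewrite le_eqVlt => /orP[/eqP<-|a0 b0 _]; last exact: ltr_pwDl.
  rewrite le_eqVlt => /orP[/eqP<-|b0 _]; last by rewrite add0r.
  by rewrite expr0n addr0 eqxx.
have cone := @side_cone R _ _ (levelG d)
  (derive1_ge0_homo dA (fun l => (mon l).1)) (derive1_ge0_homo dB (fun l => (mon l).2))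
  AB_incr (contD _ dA) (contD _ dB) G_cont G_curve.
have [p /= p_lt0] := ne minus; have [q /= q_gt0] := ne plus.
have [z' pos] : exists z', forall z, region d j z -> levelG d z * levelG d z' < 0.
  case: j => /=; [exists q|exists p] => z /= zj.
    by rewrite nmulr_rlt0.
  by rewrite pmulr_rlt0.
have [z zj] := ne j; have [c c1 cc] := cone z z' (pos z zj).
exists c => //.
have -> : region d j = [set y | 0 < levelG d z * levelG d y] by
  case: j zj {pos} => /= zj; apply/seteqP; split=> y /=;
    rewrite ?(nmulr_rgt0 _ zj) ?(pmulr_rgt0 _ zj).
exact: cc.
Qed.

(** * Differentiating an integral in its upper limit, and limits along lines *)

Lemma cvg_at_self (R : realType) (T : topologicalType) (f : T -> R) (x : T) (L : R) :
  f y @[y --> x] --> L -> f x = L.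
Proof.
move=> fL; apply/eqP; rewrite eq_sym -subr_eq0 -normr_le0; apply/ler_addgt0Pr => e e0.
rewrite add0r; apply: ltW.
exact: (nbhs_singleton ((cvgrPdist_lt _ _).1 fL e e0)).
Qed.

(* Convergence at every point of [0, T[ of the restriction to ]0, T[ amounts to
   continuity in ]0, T[ together with the existence of a limit at 0+. *)
Lemma is_derive_Rintegral (R : realType) (f : R -> R) (T t : R) :
  (forall x : R, 0 <= x < T -> cvg (f @ within `]0, T[ (nbhs x))) -> 0 < t < T ->
  is_derive t 1 (fun x => \int[@lebesgue_measure R]_(y in `[0, x]) f y) (f t).
Proof.
move=> cf /andP[t0 tT].
pose L0 : R := lim (f @ within `]0, T[ (nbhs 0)).
(* The value of [f] at 0 is arbitrary; replacing it by the limit at 0+ gives continuity on closed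
   intervals starting at 0. *)
pose F (x : R) : R := if x <= 0 then L0 else f x.
have fF (x : R) : 0 < x -> f x = F x by rewrite /F => x0; rewrite leNgt x0.
have fc (x : R) : 0 < x -> x < T -> {for x, continuous F}.
  move=> x0 xT.
  have cx : exists L : R, F y @[y --> x] --> L.
    have /cvg_ex[L HL] : cvg (f @ within `]0, T[ (nbhs x)).
      by apply: cf; rewrite ltW.
    exists L => S /HL H.
    have {}H : \forall y \near x, `]0, T[%classic y -> S (f y) := H.
    have nx0 : \forall y \near x, 0 < y by exact: lt_nbhsr.
    have nxT : \forall y \near x, y < T by exact: lt_nbhsl.
    suff : \forall y \near x, S (F y) by [].
    apply: filterS3 H nx0 nxT => y Hy y0 yT.
    by rewrite -fF//; apply: Hy; rewrite /= in_itv /= y0.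
  have [L HL] := cx.
  by have FL := cvg_at_self HL; rewrite -FL in HL.
pose u := (t + T) / 2.
have [tu uT] : t < u /\ u < T by rewrite /u; split; lra.
have u0 : 0 < u by exact: lt_trans tu.
have cF0 : F x @[x --> 0^'+] --> F 0.
  rewrite /F lexx.
  have H0 : cvg (f @ within `]0, T[ (nbhs 0)) by apply: cf; rewrite lexx (lt_trans t0).
  move=> S /H0 H.
  have {}H : \forall y \near (0:R), `]0, T[%classic y -> S (f y) := H.
  have nT : \forall y \near (0:R), y < T by apply: lt_nbhsl; exact: lt_trans tT.
  apply: filterS2 H nT => y Hy yT y0.
  by rewrite -[_ y]/(S (F y)) -fF//; apply: Hy; rewrite /= in_itv /= y0.
have cF : {within `[0, u], continuous F}.
  apply/continuous_within_itvP => //; split=> //.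
    by move=> x; rewrite in_itv /= => /andP[x0 xu]; apply: fc => //; exact: lt_trans uT.
  have : {for u, continuous F} by exact: fc.
  by apply: cvg_trans; apply: cvg_app; exact: cvg_within.
have iF : (@lebesgue_measure R).-integrable `[0, u] (EFin \o F).
  by apply: continuous_compact_integrable => //; exact: segment_compact.
have [dF F't] := continuous_FTC1 (a := BLeft 0) tu iF t0 (fc _ t0 tT).
have H : is_derive t 1 (fun x => \int[@lebesgue_measure R]_(y in `[0, x]) F y) (f t).
  by apply: DeriveDef => //; rewrite -derive1E F't fF.
apply: near_eq_is_derive H.
have nt0 : \forall y \near t, 0 < y by exact: lt_nbhsr.
have ntu : \forall y \near t, y < u by exact: lt_nbhsl.
apply: filterS2 nt0 ntu => x x0 xu.
have iFx : (@lebesgue_measure R).-integrable `]0, x] (EFin \o F).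
  apply: integrableS iF => //; apply: subset_itv; rewrite bnd_simp //; exact: ltW.
(* The end point 0, where [F] and [f] may differ, is dropped from both integrals. *)
rewrite -[LHS]Rintegral_itv_obnd_cbnd // -[RHS]Rintegral_itv_obnd_cbnd; last first.
  apply: eq_integrable iFx => // y; rewrite inE /= in_itv /= => /andP[y0 _].
  by rewrite fF.
by apply: eq_Rintegral => y; rewrite inE /= in_itv /= => /andP[y0 _]; rewrite fF.
Qed.

Lemma cvg_line (R : realType) (E : set (R * R)) (f : R * R -> R) (T x l L : R) :
  (forall y, 0 < y < T -> E (y, l)) -> f z @[z --> within E (nbhs (x, l))] --> L ->
  f (y, l) @[y --> within `]0, T[ (nbhs x)] --> L.
Proof.
move=> EE fL S /fL H.
have {}H : \forall z \near (x, l), E z -> S (f z) := H.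
move/near_squareP : H => [e e0 eS].
suff : \forall y \near x, `]0, T[%classic y -> S (f (y, l)) by [].
apply: filterS (nbhsx_ballx x _ e0) => y yx; rewrite /= in_itv /= => y0T.
apply: eS; last exact: EE.
  by rewrite /= distrC.
by rewrite /= subrr normr0.
Qed.

Lemma cvg_comp_within (R : realType) (T : Type) (F : set_system T) (FF : Filter F)
    (E : set (R * R)) (f : R * R -> R) (a b : T -> R) (a0 b0 : R) :
  a y @[y --> F] --> a0 -> b y @[y --> F] --> b0 ->
  (\forall y \near F, E (a y, b y)) -> E (a0, b0) -> {within E, continuous f} ->
  f (a y, b y) @[y --> F] --> f (a0, b0).
Proof.
move=> aa bb FE E0 /subspace_continuousP/(_ _ E0) cf S /cf H.
have {}H : \forall z \near (a0, b0), E z -> S (f z) := H.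
move/near_squareP : H => [e e0 eS].
move/cvgrPdist_lt : aa => /(_ _ e0) Ha.
move/cvgrPdist_lt : bb => /(_ _ e0) Hb.
suff : \forall y \near F, S (f (a y, b y)) by [].
apply: filterS3 FE Ha Hb => y Ey ay by'.
by apply: eS => //=; rewrite distrC.
Qed.

(** * Derivatives of the end point of a characteristic *)

Section Characteristics.
Context (R : realType) (c : R) (D : set (R * R)).
Hypotheses (c1 : c = 1 \/ c = -1) (cD : cone_closed c D).

(** Taking [e] to be [a] or [b] covers both coordinates of the characteristic map. The extra [f p]
    in the time derivative comes from the explicit factor [z.1]. *)
Lemma is_derive_characteristic (f a b e : R * R -> R) (t l : R) :
  C1_upto D (closure D) f ->
  differentiable a (t, l) -> differentiable b (t, l) -> differentiable e (t, l) ->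
  (\forall z \near (t, l), closure D (a z, b z)) ->
  let p := (a (t, l), b (t, l)) in
  is_derive ((t, l) : R * R) ((1, 0) : R * R) (fun z => e z + z.1 * f (a z, b z))
    (d1 e (t, l) + (f p + t * (d1_upto D f p * d1 a (t, l) +
      d2_upto D f p * d1 b (t, l)))) /\
  is_derive ((t, l) : R * R) ((0, 1) : R * R) (fun z => e z + z.1 * f (a z, b z))
    (d2 e (t, l) + t * (d1_upto D f p * d2 a (t, l) +
      d2_upto D f p * d2 b (t, l))).
Proof.
move=> fD da db de /near_squareP[r r0 rD] p.
have dP (g : R * R -> R) v : differentiable g (t, l) -> is_derive (t, l) v g ('D_v g (t, l)).
  by move=> dg; apply/derivableP/diff_derivable.
split.
  apply/is_derive_fst => /=.
  have /is_derive_fst a' := dP a (1, 0) da; have /is_derive_fst b' := dP b (1, 0) db.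
  have /is_derive_fst e' := dP e (1, 0) de.
  have n : \forall y \near t, closure D (a (y, l), b (y, l)).
    apply: filterS (nbhsx_ballx t _ r0) => y yt; apply: rD.
      by rewrite /= distrC.
    by rewrite /= subrr normr0.
  have f' := is_derive_comp_upto c1 cD fD a' b' n.
  have tf' := is_deriveM (is_derive_id t (1 : R)) f'.
  refine (is_derive_eq (is_deriveD e' tf') _).
  by rewrite /= /GRing.scale /= /d1 mulr1; ring.
apply/is_derive_snd => /=.
have /is_derive_snd a' := dP a (0, 1) da; have /is_derive_snd b' := dP b (0, 1) db.
have /is_derive_snd e' := dP e (0, 1) de.
have n : \forall y \near l, closure D (a (t, y), b (t, y)).
  apply: filterS (nbhsx_ballx l _ r0) => y yl; apply: rD.
    by rewrite /= subrr normr0.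
  by rewrite /= distrC.
have f' := is_derive_comp_upto c1 cD fD a' b' n.
have tf' := is_deriveM (is_derive_cst t l (1 : R)) f'.
refine (is_derive_eq (is_deriveD e' tf') _).
by rewrite /= /GRing.scale /= /d2; ring.
Qed.

End Characteristics.

(** * Inflow of mass and momentum into the shock *)

Section ShockCurve.
Context (R : realType) (d : initial_data R) (T : R) (s : shock_data R).
Context (P : R -> {measure set (R * R) -> \bar R}) (u v : R -> R * R -> R).
Hypotheses (hT : 0 < T) (hdata : admissible_data d)
  (hshock : single_shock d T s P u v) (hformulas : shock_formulas d T s).

Lemma region_neq0 j : region d j !=set0.
Proof.
have h : (0 : R) <= 0 < T by rewrite lexx hT.
have : closure (region d j) (foot s j 0 0) by exact: (foot_region hshock).
move=> /(_ setT filterT) [p [rp _]].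
by exists p.
Qed.

Lemma strip_near (t l : R) : 0 < t < T -> \forall z \near (t, l), strip T z.
Proof.
move=> /andP[t0 tT]; apply/near_squareP.
exists (Num.min t (T - t)); first by rewrite lt_min t0 subr_gt0.
move=> z; rewrite /= lt_min !ltr_norml /strip /= => /andP[/andP[h1 h2] /andP[h3 h4]] _.
by apply/andP; split; lra.
Qed.

Lemma foot_near j (t l : R) : 0 < t < T ->
  \forall z \near (t, l), closure (region d j) (sa s j z, sb s j z).
Proof.
move=> tT; apply: filterS (strip_near l tT) => -[t' l'] /andP[/= t0 t1].
by apply: (foot_region hshock); rewrite ltW.
Qed.

Lemma foot_charmap_fst j (t l : R) : 0 <= t < T ->
  sx s (t, l) = sa s j (t, l) + t * velu0 d j (sa s j (t, l), sb s j (t, l)).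
Proof.
move=> tT.
by have [-> _] : charmap d j t (foot s j t l) = gamma s t l by exact: (foot_gamma hshock).
Qed.

Lemma foot_charmap_snd j (t l : R) : 0 <= t < T ->
  sy s (t, l) = sb s j (t, l) + t * velv0 d j (sa s j (t, l), sb s j (t, l)).
Proof.
move=> tT.
by have [_ ->] : charmap d j t (foot s j t l) = gamma s t l by exact: (foot_gamma hshock).
Qed.

(** The feet and their derivatives have limits down to time 0, and the feet stay in the closed
    region where [g] is continuous. This is what differentiating the inflow integral requires. *)
Lemma integrand_cvg (g : side -> R * R -> R) (l x : R) :
  (forall j, {within closure (region d j), continuous (g j)}) -> 0 <= x < T ->
  cvg ((fun y => g plus (foot s plus y l) * Mfoot s plus y l
     - g minus (foot s minus y l) * Mfoot s minus y l) @ within `]0, T[ (nbhs x)).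
Proof.
move=> cg xT.
have st0 y : 0 < y < T -> strip0 T (y, l) by move=> /andP[y0 yT]; rewrite /strip0 /= ltW.
have side j : cvg ((fun y => g j (foot s j y l) * Mfoot s j y l) @ within `]0, T[ (nbhs x)).
  have [_ ca ca1 ca2] := sa_C1 hshock j; have [_ cb cb1 cb2] := sb_C1 hshock j.
  have line (f : R * R -> R) : cvg (f @ within (strip T) (nbhs (x, l))) ->
      cvg ((fun y => f (y, l)) @ within `]0, T[ (nbhs x)).
    by move=> /cvg_ex[L HL]; apply/cvg_ex; exists L; apply: (cvg_line _ HL).
  apply: is_cvgM; last first.
    by apply: is_cvgB; apply: is_cvgM; apply: line;
      [exact: ca1|exact: cb2|exact: cb1|exact: ca2].
  apply/cvg_ex; exists (g j (foot s j x l)).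
  apply: (cvg_comp_within _ _ _ _ _ (cg j)).
  - by move/subspace_continuousP/(_ (x, l) xT) : ca; exact: cvg_line.
  - by move/subspace_continuousP/(_ (x, l) xT) : cb; exact: cvg_line.
  - suff : \forall y \near x, `]0, T[%classic y -> closure (region d j) (foot s j y l) by [].
    apply: (@nearW _ (nbhs x)) => y; rewrite /= in_itv /= => y0T.
    by apply: (foot_region hshock); exact: st0 y0T.
  - exact: (foot_region hshock).
by apply: is_cvgB; exact: side.
Qed.

Lemma is_derive_inflow (g : side -> R * R -> R) (f : R * R -> R) (t l : R) :
  (forall j, {within closure (region d j), continuous (g j)}) -> 0 < t < T ->
  (forall x l : R, 0 <= x < T -> f (x, l) = inflow s g x l) ->
  is_derive ((t, l) : R * R) ((1, 0) : R * R) f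
    (g plus (foot s plus t l) * Mfoot s plus t l
     - g minus (foot s minus t l) * Mfoot s minus t l).
Proof.
move=> cg tT fE; apply/is_derive_fst.
have H := is_derive_Rintegral (fun x : R => @integrand_cvg g l x cg) tT.
apply: near_eq_is_derive H.
move: tT => /andP[t0 t1].
have n0 : \forall y \near t, 0 < y by exact: lt_nbhsr.
have n1 : \forall y \near t, y < T by exact: lt_nbhsl.
by apply: filterS2 n0 n1 => y y0 y1; rewrite fE// ltW.
Qed.

(* The Jacobian matrix of the characteristic map sends the time derivative of the
   foot to the velocity of the surface relative to side [j], and its [l] derivative
   to [(x_l, y_l)]; take determinants. *)
Lemma foot_flux j (t l : R) : 0 < t < T ->
  [/\ derivable (sx s) (t, l) (0, 1), derivable (sy s) (t, l) (0, 1),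
      su s j t (gamma s t l) = velu0 d j (foot s j t l),
      sv s j t (gamma s t l) = velv0 d j (foot s j t l) &
      dens0 d j (foot s j t l) * Mfoot s j t l =
      srho s j t (gamma s t l) *
        ((Ush s t l - su s j t (gamma s t l)) * d2 (sy s) (t, l) -
         (Vsh s t l - sv s j t (gamma s t l)) * d2 (sx s) (t, l))].
Proof.
move=> tT.
have tT' : 0 <= t < T by move: tT => /andP[t0 ->]; rewrite ltW.
have [c c1 cD] := region_cone hdata region_neq0 j.
have da : differentiable (sa s j) (t, l).
  by have [da _ _ _] := sa_C1 hshock j; exact: da.
have db : differentiable (sb s j) (t, l).
  by have [db _ _ _] := sb_C1 hshock j; exact: db.
have [x_t' x_l'] := is_derive_characteristic c1 cD (velu0_C1 hdata j)
  da db da (foot_near j l tT).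
have [y_t' y_l'] := is_derive_characteristic c1 cD (velv0_C1 hdata j)
  da db db (foot_near j l tT).
(* The surface and the characteristic formula agree for times in [[0, T[], hence near [(t, l)],
   which is enough to identify derivatives. *)
have xE : \forall z \near (t, l), sa s j z + z.1 * velu0 d j (sa s j z, sb s j z) = sx s z.
  apply: filterS (strip_near l tT) => -[t' l'] /andP[/= t0 t1].
  by rewrite -foot_charmap_fst// ltW.
have yE : \forall z \near (t, l), sb s j z + z.1 * velv0 d j (sa s j z, sb s j z) = sy s z.
  apply: filterS (strip_near l tT) => -[t' l'] /andP[/= t0 t1].
  by rewrite -foot_charmap_snd// ltW.
have {x_t'} [_ x_tE] := near_eq_is_derive xE x_t'.
have {y_t'} [_ y_tE] := near_eq_is_derive yE y_t'.
have {x_l'} [x_l x_lE] := near_eq_is_derive xE x_l'.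
have {y_l'} [y_l y_lE] := near_eq_is_derive yE y_l'.
have [_ UE] := gamma_dx hformulas l tT; have [_ VE] := gamma_dy hformulas l tT.
have cl : closure (region d j) (foot s j t l) by exact: (foot_region hshock).
have footE : charmap d j t (foot s j t l) = gamma s t l by exact: (foot_gamma hshock).
have : (slice s j t `|` range (gamma s t)) (charmap d j t (foot s j t l)).
  by right; exists l.
move=> /(classical_formula hshock tT cl) /=; rewrite footE => -[jac -> -> ->].
split=> //.
have {}x_lE : d2 (sx s) (t, l) = _ := x_lE.
have {}y_lE : d2 (sy s) (t, l) = _ := y_lE.
(* With the partial derivatives as independent variables, multiplicativity of the 2 by 2 determinant
   is a rational identity; [jac] permits division by the Jacobian. *)
move: jac; rewrite /charjac -UE x_tE -VE y_tE x_lE y_lE /Mfoot /foot.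
move: (sa s j (t, l), sb s j (t, l)) => p.
move: (d1 (sa s j) _) (d2 (sa s j) _) (d1 (sb s j) _) (d2 (sb s j) _).
move: (d1_upto _ (velu0 d j) _) (d2_upto _ (velu0 d j) _).
move: (d1_upto _ (velv0 d j) _) (d2_upto _ (velv0 d j) _).
by move=> g1 g2 g3 g4 g5 g6 g7 g8 jac; field.
Qed.

End ShockCurve.

(** * The system on the shock *)

Theorem theorem4p1 (R : realType) (d : initial_data R) (T : R)
  (P : R -> {measure set (R * R) -> \bar R}) (u v : R -> R * R -> R)
  (s : shock_data R)
  (hT : 0 < T)
  (hdata : admissible_data d)
  (hsmall : small_time d T)
  (hsol : generalized_solution T P u v (two_sided d (dens0 d))
            (two_sided d (velu0 d)) (two_sided d (velv0 d)))
  (hshock : single_shock d T s P u v)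
  (hformulas : shock_formulas d T s)
  (t l : R) (ht : 0 < t < T) :
  let U := Ush s t l in
  let V := Vsh s t l in
  let q := (sx s (t, l), sy s (t, l)) in
  let x_l := d2 (sx s) (t, l) in
  let y_l := d2 (sy s) (t, l) in
  let rp := srho s plus t q in
  let up := su s plus t q in
  let vp := sv s plus t q in
  let rm := srho s minus t q in
  let um := su s minus t q in
  let vm := sv s minus t q in
  [/\ derivable (sx s) (t, l) (0, 1) /\ derivable (sy s) (t, l) (0, 1),
      derivable (sP s) (t, l) (1, 0) /\
      d1 (sP s) (t, l)
      + x_l * (V * (rp - rm) - (rp * vp - rm * vm))
      + y_l * ((rp * up - rm * um) - U * (rp - rm)) = 0,
      derivable (sI s) (t, l) (1, 0) /\
      d1 (sI s) (t, l)
      + x_l * (V * (rp * up - rm * um) - (rp * up * vp - rm * um * vm))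
      + y_l * ((rp * up ^+ 2 - rm * um ^+ 2) - U * (rp * up - rm * um)) = 0,
      derivable (sJ s) (t, l) (1, 0) /\
      d1 (sJ s) (t, l)
      + x_l * (V * (rp * vp - rm * vm) - (rp * vp ^+ 2 - rm * vm ^+ 2))
      + y_l * ((rp * up * vp - rm * um * vm) - U * (rp * vp - rm * vm)) = 0 &
      is_derive ((t, l) : R * R) ((1, 0) : R * R) (sy s) V /\
      is_derive ((t, l) : R * R) ((1, 0) : R * R) (sx s) U].
Proof.
move=> /=.
have [xl yl sup svp flux_p] := foot_flux hT hdata hshock hformulas plus l ht.
have [_ _ sum svm flux_m] := foot_flux hT hdata hshock hformulas minus l ht.
have cont0 (f : side -> R * R -> R) :
    (forall j, C1_upto (region d j) (closure (region d j)) (f j)) ->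
    forall j, {within closure (region d j), continuous (f j)}.
  by move=> fC j; have [] := fC j.
have crho := cont0 _ (dens0_C1 hdata).
have cu := cont0 _ (velu0_C1 hdata); have cv := cont0 _ (velv0_C1 hdata).
have cM (f g : side -> R * R -> R) j :
    {within closure (region d j), continuous (f j)} ->
    {within closure (region d j), continuous (g j)} ->
    {within closure (region d j), continuous (fun p => f j p * g j p)}.
  by move=> cf cg x; apply: cvgM; [exact: cf|exact: cg].
have [dP PE] := is_derive_inflow hshock l crho ht
  (fun x m => sP_formula hformulas (t := x) m).
have [dI IE] := is_derive_inflow hshock l (fun j => cM _ _ j (crho j) (cu j)) ht
  (fun x m => sI_formula hformulas (t := x) m).
have [dJ JE] := is_derive_inflow hshock l (fun j => cM _ _ j (crho j) (cv j)) ht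
  (fun x m => sJ_formula hformulas (t := x) m).
have {}PE : d1 (sP s) (t, l) = _ := PE.
have {}IE : d1 (sI s) (t, l) = _ := IE.
have {}JE : d1 (sJ s) (t, l) = _ := JE.
(* The velocity factor is moved aside to expose the mass flux, then read at the surface point, since
   velocities are constant along characteristics. *)
rewrite /= mulrAC flux_p [X in _ = _ - X]mulrAC flux_m -sup -sum in IE.
rewrite /= mulrAC flux_p [X in _ = _ - X]mulrAC flux_m -svp -svm in JE.
rewrite flux_p flux_m in PE.
rewrite -/(gamma s t l); split; first exact: conj xl yl.
- by split; [exact: dP|rewrite PE; ring].
- by split; [exact: dI|rewrite IE; ring].
- by split; [exact: dJ|rewrite JE; ring].
- by split; [exact: (gamma_dy hformulas)|exact: (gamma_dx hformulas)].
Qed.
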